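(* Let $(X,\varphi)$ be a Cantor minimal system. (1) If $H$ is a non-trivial normal subgroup of $[\varphi]$, or a non-trivial normal subgroup of $D([\varphi])$, then $D([\varphi])\subseteq H$. (2) If $H$ is a non-trivial normal subgroup of $[[\varphi]]$, or a non-trivial normal subgroup of $D([[\varphi]])$, then $D([[\varphi]])\subseteq H$. In particular, the groups $D([\varphi])$ and $D([[\varphi]])$ are simple.
   Context: A Cantor set is a (non-empty) zero-dimensional compact metric space without isolated points. $H(X)$ is the group of all homeomorphisms of $X$. A Cantor minimal system $(X,\varphi)$ is a Cantor set $X$ with $\varphi\in H(X)$ such that every orbit $Orb_\varphi(x)=\{\varphi^n(x):n\in\mathbb Z\}$ is dense in $X$. The full group $[\varphi]$ is the set of all $f\in H(X)$ with $f(x)\in Orb_\varphi(x)$ for all $x\in X$; for $f\in[\varphi]$ there is a cocycle $n_f:X\to\mathbb Z$ with $f(x)=\varphi^{n_f(x)}(x)$ for all $x$. The topological full group $[[\varphi]]$ is the set of all $f\in[\varphi]$ for which $n_f$ is continuous. For a group $G$, $D(G)$ is the commutator subgroup, generated by all $[f,g]=fgf^{-1}g^{-1}$ with $f,g\in G$. *)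

(* Defs.v *)
From HB Require Import structures.
From mathcomp Require Import all_boot all_order all_algebra.
From mathcomp Require Import all_classical all_reals topology.

Set Implicit Arguments.
Unset Strict Implicit.
Unset Printing Implicit Defensive.

Import monoid.

Local Open Scope classical_set_scope.
Local Open Scope group_scope.

(* Subgroups of a possibly infinite group are classical sets of elements. *)
Section Subgroups.
Variable G : groupType.
Implicit Types H K : set G.

Definition is_subgroup H : Prop :=
  [/\ H 1,
      forall x y, H x -> H y -> H (x * y) &
      forall x, H x -> H x^-1].

Definition normal_subgroup H K : Prop :=
  [/\ is_subgroup H,
      H `<=` K &
      forall k h, K k -> H h -> H (k * h * k^-1)].

Definition nontrivial H : Prop := H <> [set 1].

(* The commutators are f g f^-1 g^-1, whereas the library's [~ f, g] is
   f^-1 g^-1 f g. *)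
Definition commutator_subgroup K : set G :=
  smallest is_subgroup [set f * g * f^-1 * g^-1 | f in K & g in K].

Definition simple_subgroup K : Prop :=
  [/\ is_subgroup K,
      nontrivial K &
      forall H, normal_subgroup H K -> H = [set 1] \/ H = K].

Definition expgz (g : G) (n : int) : G :=
  match n with
  | Posz k => g ^+ k
  | Negz k => g ^- k.+1
  end.

End Subgroups.

Record homeo (X : topologicalType) := Homeo {
  homeo_fun :> X -> X;
  homeo_inv : X -> X;
  homeo_funK : cancel homeo_fun homeo_inv;
  homeo_invK : cancel homeo_inv homeo_fun;
  homeo_fun_continuous : continuous homeo_fun;
  homeo_inv_continuous : continuous homeo_inv
}.

Section HomeoGroup.
Variable X : topologicalType.
Implicit Types f g h : homeo X.

Lemma homeo_ext f g : f =1 g -> f = g.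
Proof.
case: f g => [f f' fK f'K cf cf'] [g g' gK g'K cg cg'] /= fg.
have efg : f = g by apply/funext.
subst g.
have efg' : f' = g' by apply/funext => x; rewrite -{1}(g'K x) fK.
subst g'.
by rewrite (Prop_irrelevance fK gK) (Prop_irrelevance f'K g'K)
  (Prop_irrelevance cf cg) (Prop_irrelevance cf' cg').
Qed.

Definition homeo_one : homeo X :=
  @Homeo X id id (fun=> erefl) (fun=> erefl) (fun=> cvg_id) (fun=> cvg_id).

Definition homeo_inverse f : homeo X :=
  @Homeo X (homeo_inv f) f (@homeo_invK _ f) (@homeo_funK _ f)
    (@homeo_inv_continuous _ f) (@homeo_fun_continuous _ f).

Definition homeo_comp f g : homeo X :=
  @Homeo X (f \o g) (homeo_inv g \o homeo_inv f)
    (can_comp (@homeo_funK _ f) (@homeo_funK _ g))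
    (can_comp (@homeo_invK _ g) (@homeo_invK _ f))
    (fun x => continuous_comp (@homeo_fun_continuous _ g x)
                (@homeo_fun_continuous _ f (g x)))
    (fun x => continuous_comp (@homeo_inv_continuous _ f x)
                (@homeo_inv_continuous _ g (homeo_inv f x))).

Lemma homeo_compA : associative homeo_comp.
Proof. by move=> f g h; apply: homeo_ext. Qed.

Lemma homeo_comp1f : left_id homeo_one homeo_comp.
Proof. by move=> f; apply: homeo_ext. Qed.

Lemma homeo_compf1 : right_id homeo_one homeo_comp.
Proof. by move=> f; apply: homeo_ext. Qed.

Lemma homeo_compVf : left_inverse homeo_one homeo_inverse homeo_comp.
Proof. by move=> f; apply: homeo_ext => x; exact: homeo_funK. Qed.

Lemma homeo_compfV : right_inverse homeo_one homeo_inverse homeo_comp.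
Proof. by move=> f; apply: homeo_ext => x; exact: homeo_invK. Qed.

End HomeoGroup.

HB.instance Definition _ (X : topologicalType) := gen_eqMixin (homeo X).
HB.instance Definition _ (X : topologicalType) := gen_choiceMixin (homeo X).
HB.instance Definition _ (X : topologicalType) :=
  isGroup.Build (homeo X) (@homeo_compA X) (@homeo_comp1f X)
    (@homeo_compf1 X) (@homeo_compVf X) (@homeo_compfV X).

(* zero_dimensional is the library's notion (clopen sets separate points); on a
   compact metric space it amounts to having a base of clopen sets. *)
Definition cantor_set (R : realType) (X : metricType R) : Prop :=
  [/\ [set: X] !=set0,
      compact [set: X],
      zero_dimensional X &
      isolated [set: X] = set0].

Definition homeo_orbit (X : topologicalType) (phi : homeo X) (x : X) : set X :=
  [set expgz phi n x | n in [set: int]].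

Definition cantor_minimal_system (R : realType) (X : metricType R)
    (phi : homeo X) : Prop :=
  cantor_set X /\ forall x, dense (homeo_orbit phi x).

Definition full_group (X : topologicalType) (phi : homeo X) : set (homeo X) :=
  [set f : homeo X | forall x, homeo_orbit phi x (f x)].

Definition is_cocycle (X : topologicalType) (phi f : homeo X)
    (n : X -> int) : Prop :=
  forall x, f x = expgz phi (n x) x.

(* In a Cantor minimal system phi has no periodic point, so that the cocycle of
   f is unique: "some cocycle is continuous" says that n_f is. *)
Definition topological_full_group (X : topologicalType) (phi : homeo X) :
    set (homeo X) :=
  [set f | full_group phi f /\
     exists n : X -> discrete_topology int,
       is_cocycle phi f n /\ continuous n].

(* Main.v *)
Require Import Defs.
From mathcomp Require Import all_boot all_order all_algebra.
From mathcomp Require Import all_classical all_reals topology.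
From mathcomp Require Import normedtype sequences lra zify.

(** Write D for the commutator subgroup of K, where K is the full group or the
    topological full group, and let H be a non-trivial subgroup normalized by D;
    the claim is that D is contained in H, and everything else follows.

    Some h in H moves a non-empty clopen set U off itself. For f and g in D
    supported in U the double commutator [[f, h], g] lies in H, and it equals
    [f, g] because g commutes with the conjugate of f by h. So H contains all
    commutators of elements of D supported in U. This propagates to all of D
    through the notion of size given by the phi-invariant means: for every
    e > 0 the group K is generated by its elements supported in a clopen set of
    mean < e for all means (full_group_generators), and these form a conjugation
    invariant set, so that D is generated by the commutators of two of them
    (commutator_subgroup_generators). If s and t are two such elements, then
    [s, t] = [[s, rho], [t, rho']] where rho and rho' move the supports of s and
    t to disjoint places, and the two inner commutators, which lie in D and
    still have small support, can be conjugated into U by an element of D.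

    All the moves come from a comparison property (clopen_comparison): a clopen
    set which is smaller than B for all means can be moved into B by an element
    of the topological full group. It is obtained by matching greedily the
    points of A with points of B on the same orbit; were this never to end, an
    ultralimit of orbit statistics would be a mean contradicting the
    hypothesis. The other fact about means is that they are invariant on clopen
    sets under the whole full group, although the cocycle of an element may be
    unbounded there (full_group_mean). *)

Set Implicit Arguments.
Unset Strict Implicit.
Unset Printing Implicit Defensive.

Import monoid Order.TTheory GRing.Theory Num.Theory.
Import numFieldNormedType.Exports.

Local Open Scope classical_set_scope.
Local Open Scope group_scope.

(** * Commutator subgroups *)

Section Commutators.
Variable G : groupType.
Implicit Types (H K S : set G) (f g h k s t : G).

Definition comm f g := f * g * f^-1 * g^-1.

Lemma smallest_subgroup S : is_subgroup (smallest (@is_subgroup G) S).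
Proof.
split=> [P [[]]//|x y Sx Sy P SP|x Sx P SP].
  by case: (SP) => -[_ PM _] _; exact: PM (Sx _ SP) (Sy _ SP).
by case: (SP) => -[_ _ PV] _; exact: PV (Sx _ SP).
Qed.

Lemma commutator_subgroup_comm K f g :
  K f -> K g -> commutator_subgroup K (comm f g).
Proof. by move=> Kf Kg; apply: sub_gen_smallest; exists f => //; exists g. Qed.

Lemma commutator_subgroup_sub K :
  is_subgroup K -> commutator_subgroup K `<=` K.
Proof.
move=> sK; apply: smallest_sub => // _ [f Kf [g Kg <-]]; case: sK => _ KM KV.
by apply: (KM _ _ (KM _ _ (KM _ _ Kf Kg) (KV _ Kf)) (KV _ Kg)).
Qed.

Lemma comm_conj k f g : k * comm f g * k^-1 = comm (k * f * k^-1) (k * g * k^-1).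
Proof. by rewrite /comm !invgM !invgK !mulgA !mulgVK. Qed.

Lemma comm_inv f g : (comm f g)^-1 = comm g f.
Proof. by rewrite /comm !invgM !invgK !mulgA. Qed.

Lemma comm_mull f g t : comm (f * g) t = f * comm g t * f^-1 * comm f t.
Proof. by rewrite /comm !invgM !mulgA !mulgVK. Qed.

Lemma comm_invl f t : comm f^-1 t = f^-1 * (comm f t)^-1 * f.
Proof. by rewrite comm_inv /comm invgK !mulgA mulgVK. Qed.

Lemma comm1l t : comm 1 t = 1.
Proof. by rewrite /comm invg1 mul1g mulg1 mulgV. Qed.

(** Modulo the subgroup generated by the commutators of S, which is normal
    because S is conjugation invariant, the generators commute. *)
Lemma commutator_subgroup_generators K S H :
    is_subgroup K -> S `<=` K -> K `<=` smallest (@is_subgroup G) S ->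
    (forall k s, K k -> S s -> S (k * s * k^-1)) ->
    is_subgroup H -> (forall s t, S s -> S t -> H (comm s t)) ->
  commutator_subgroup K `<=` H.
Proof.
move=> sK SK KS SJ sH HS.
pose P := smallest (@is_subgroup G) [set comm s t | s in S & t in S].
have sP : is_subgroup P by exact: smallest_subgroup.
have [[K1 KM KV] [P1 PM PV]] := (sK, sP).
have PJ k p : K k -> P p -> P (k * p * k^-1).
  move=> Kk Pp; suff : P `<=` [set p | P (k * p * k^-1)] by exact.
  apply: smallest_sub => /=; first split=> /= [|x y Px Py|x Px].
  - by rewrite mulg1 mulgV.
  - have -> : k * (x * y) * k^-1 = (k * x * k^-1) * (k * y * k^-1).
      by rewrite !mulgA mulgVK.
    exact: PM.
  - have -> : k * x^-1 * k^-1 = (k * x * k^-1)^-1.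
      by rewrite !invgM invgK !mulgA.
    exact: PV.
  move=> _ [s Ss [t St <-]]; rewrite /= comm_conj; apply: sub_gen_smallest.
  by exists (k * s * k^-1); [exact: SJ|exists (k * t * k^-1) => //; exact: SJ].
have centr_sub t : K t -> is_subgroup [set f | K f /\ P (comm f t)].
  move=> Kt; split=> /= [|f g [Kf Pf] [Kg Pg]|f [Kf Pf]].
  - by rewrite comm1l.
  - by split; [exact: KM|rewrite comm_mull; apply: (PM) => //; exact: PJ].
  - split; [exact: KV|rewrite comm_invl].
    by rewrite -{3}[f]invgK; apply: (PJ); [exact: KV|exact: PV].
have PKS f t : K f -> S t -> P (comm f t).
  move=> Kf St; suff : K `<=` [set f | K f /\ P (comm f t)] by case/(_ f Kf).
  apply: subset_trans KS _; apply: smallest_sub; first exact: centr_sub (SK _ St).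
  by move=> s Ss; split; [exact: SK|apply: sub_gen_smallest; exists s => //; exists t].
have PKK f g : K f -> K g -> P (comm f g).
  move=> Kf Kg; rewrite -comm_inv; apply: (PV).
  suff : K `<=` [set g | K g /\ P (comm g f)] by case/(_ g Kg).
  apply: subset_trans KS _; apply: smallest_sub; first exact: centr_sub.
  by move=> s Ss; split; [exact: SK|rewrite -comm_inv; apply: (PV); exact: PKS].
apply: (@subset_trans _ P); apply: smallest_sub => //.
  by move=> _ [f Kf [g Kg <-]]; exact: PKK.
by move=> _ [s Ss [t St <-]]; exact: HS.
Qed.

(** [f, h] is the product of f with the conjugate by h of its inverse, and g does
    not see the second factor. *)
Lemma comm_nested f g h :
  commute g (h * f * h^-1) -> comm (comm f h) g = comm f g.
Proof.
move=> gc; rewrite /comm.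
have -> : f * h * f^-1 * h^-1 = f * (h * f * h^-1)^-1.
  by rewrite !invgM !invgK !mulgA.
move: (h * f * h^-1) gc => c gc.
have gcV : c^-1 * g = g * c^-1 by exact: esym (commuteV gc).
by rewrite invgM invgK -!mulgA (mulgA c^-1 g) gcV -!mulgA mulKg.
Qed.

(** This serves to replace f and g with elements of the commutator subgroup that
    have the same commutator. *)
Lemma comm_mul_commute f g a b :
    commute a b -> commute a g -> commute b f ->
  comm (f * a) (g * b) = comm f g.
Proof.
move=> ab ag bf; rewrite /comm !invgM -!mulgA; congr (f * _).
rewrite (mulgA a g) ag -mulgA (mulgA a b) ab -mulgA mulVKg.
by rewrite (mulgA b f^-1) (commuteV bf) -mulgA mulVKg.
Qed.

End Commutators.

(** * Homeomorphisms, supports and swaps *)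

Section Homeomorphisms.
Variable X : topologicalType.
Implicit Types (f g h s : homeo X) (A B C W : set X) (x y : X).

Lemma homeoM f g x : (f * g) x = f (g x). Proof. by []. Qed.
Lemma homeoK f x : f^-1 (f x) = x. Proof. exact: homeo_funK. Qed.
Lemma homeoVK f x : f (f^-1 x) = x. Proof. exact: homeo_invK. Qed.
Lemma preimage_homeoK f A : f @^-1` ((f^-1)%g @^-1` A) = A.
Proof. by apply/seteqP; split=> x; rewrite /preimage /mkset homeoK. Qed.

Lemma homeo_inj f : injective f. Proof. exact: can_inj (homeoK f). Qed.

Lemma homeo_continuous f : continuous f.
Proof. exact: homeo_fun_continuous. Qed.

Lemma homeo_near f (P : X -> Prop) x :
  (\forall y \near f x, P y) -> \forall y \near x, P (f y).
Proof. exact: homeo_continuous. Qed.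

Lemma preimage_homeo_clopen f A : clopen A -> clopen (f @^-1` A).
Proof. by move=> cA; apply: preimage_clopen => //; exact: homeo_continuous. Qed.

Lemma clopenD A B : clopen A -> clopen B -> clopen (A `\` B).
Proof. by move=> cA cB; rewrite setDE; apply: clopenI => //; exact: clopenC. Qed.

Lemma clopen_near A x : clopen A -> A x -> \forall y \near x, A y.
Proof. by move=> [oA _] Ax; exact: open_nbhs_nbhs. Qed.

Lemma clopen_nearC A x : clopen A -> ~ A x -> \forall y \near x, ~ A y.
Proof. by move=> cA nAx; apply: (@clopen_near (~` A)) => //; exact: clopenC. Qed.

Definition supported C f := forall x, ~ C x -> f x = x.

Lemma supported_sub C B f : C `<=` B -> supported C f -> supported B f.
Proof. by move=> CB sf x nBx; apply: sf => /CB. Qed.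

Lemma supportedM C f g : supported C f -> supported C g -> supported C (f * g).
Proof. by move=> sf sg x nCx; rewrite homeoM sg ?sf. Qed.

Lemma supportedV C f : supported C f -> supported C f^-1.
Proof. by move=> sf x nCx; rewrite -[in LHS](sf x) // homeoK. Qed.

Lemma supportedJ C f g : supported C f -> supported ((g^-1)%g @^-1` C) (g * f * g^-1).
Proof. by move=> sf x nCx; rewrite !homeoM sf ?homeoVK. Qed.

Lemma supported_mem C f x : supported C f -> C x -> C (f x).
Proof.
move=> sf Cx; apply: contrapT => nCfx.
by have /homeo_inj fxx := sf _ nCfx; apply: nCfx; rewrite fxx.
Qed.

Lemma supported_commute C B f g :
  C `&` B = set0 -> supported C f -> supported B g -> commute f g.
Proof.
move=> CB sf sg; apply: homeo_ext => x; rewrite !homeoM.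
have dis y : C y -> ~ B y.
  by move=> Cy By; suff : (C `&` B) y by rewrite CB.
have [Cx|nCx] := pselect (C x).
  by rewrite (sg x (dis _ Cx)) sg //; apply: dis; exact: supported_mem Cx.
have [Bx|nBx] := pselect (B x); last by rewrite !(sf, sg).
rewrite (sf x) // sf // => /dis; apply; exact: supported_mem Bx.
Qed.

(** Each such s stays in the full group of h, being locally h, its inverse or
    the identity; the moves constructed below are products of swaps. *)
Definition is_swap h W s :=
  [/\ forall x, W x -> s x = h x,
      forall x, W x -> s (h x) = x &
      forall x, ~ W x -> ~ W (h^-1 x) -> s x = x].

Lemma local_continuous (f : X -> X) :
    (forall x, exists g, \forall y \near x, f y = g y) ->
  continuous f.
Proof.
move=> fg x; have [g xfg] := fg x.
rewrite /continuous_at (nbhs_singleton xfg).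
apply: (@cvg_trans _ (g @ x)); last exact: homeo_continuous.
by apply: near_eq_cvg; near=> y; apply/esym; near: y.
Unshelve. all: by end_near. Qed.

Lemma swap_exists h W :
    clopen W -> (forall x, W x -> ~ W (h x)) ->
  exists s, is_swap h W s.
Proof.
move=> cW dW.
pose f x := if pselect (W x) then h x else
            if pselect (W (h^-1 x)) then h^-1 x else x.
have f1 x : W x -> f x = h x by rewrite /f; case: pselect.
have f2 x : W (h^-1 x) -> f x = h^-1 x.
  rewrite /f => Whx; case: pselect => [Wx|nWx]; last by case: pselect.
  by have := dW _ Whx; rewrite homeoVK.
have f3 x : ~ W x -> ~ W (h^-1 x) -> f x = x.
  by rewrite /f; case: pselect => // ?; case: pselect.
have fK : cancel f f.
  move=> x; have [Wx|nWx] := pselect (W x).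
    by rewrite (f1 x Wx) f2 homeoK.
  have [Whx|nWhx] := pselect (W (h^-1 x)); last by rewrite !f3.
  by rewrite (f2 x Whx) f1 ?homeoVK.
have cf : continuous f.
  apply: local_continuous => x; have [Wx|nWx] := pselect (W x).
    by exists h; apply: filterS (clopen_near cW Wx) => y; exact: f1.
  have cWh := preimage_homeo_clopen h^-1 cW.
  have [Whx|nWhx] := pselect (W (h^-1 x)).
    by exists h^-1; apply: filterS (clopen_near cWh Whx) => y; exact: f2.
  exists 1; apply: filterS2 (clopen_nearC cW nWx) (clopen_nearC cWh nWhx).
  by move=> y ? ?; rewrite f3.
exists (Homeo fK fK cf cf); split=> x /=; [exact: f1| |exact: f3].
by move=> Wx; rewrite f2 homeoK.
Qed.

Lemma swap_supported h W s : is_swap h W s -> supported (W `|` (h^-1)%g @^-1` W) s.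
Proof. by case=> _ _ s3 x nWx; apply: s3 => ?; apply: nWx; [left|right]. Qed.

End Homeomorphisms.
Arguments supported {X}.

(** * Powers, orbits and full groups *)

Section Powers.
Variable G : groupType.
Implicit Types (g : G) (m n : int).

Lemma expgzS g n : expgz g (1 + n)%R = g * expgz g n.
Proof.
case: n => [n|[|n]].
- have -> : (1 + Posz n)%R = Posz n.+1 by lia.
  by rewrite /= expgS.
- by rewrite /= mulgV.
- have -> : (1 + Negz n.+1)%R = Negz n by lia.
  by rewrite /= [in RHS]expgSr invgM mulVKg.
Qed.

Lemma expgzP g n : expgz g (n - 1)%R = g^-1 * expgz g n.
Proof.
by apply: (mulgI g); rewrite mulVKg -expgzS; congr expgz; lia.
Qed.

Lemma expgzD g m n : expgz g (m + n)%R = expgz g m * expgz g n.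
Proof.
elim/int_ind: m => [|m IH|m IH].
- by rewrite add0r mul1g.
- have -> : (m.+1%:Z + n = 1 + (m%:Z + n))%R by lia.
  by rewrite expgzS IH mulgA -expgzS; congr (expgz g _ * _); lia.
- have -> : (- m.+1%:Z + n = (- m%:Z + n) - 1)%R by lia.
  by rewrite expgzP IH mulgA -expgzP; congr (expgz g _ * _); lia.
Qed.

Lemma expgzN g n : expgz g (- n)%R = (expgz g n)^-1.
Proof. by apply: (mulgI (expgz g n)); rewrite -expgzD subrr mulgV. Qed.

End Powers.

Section FullGroups.
Variables (X : topologicalType) (phi : homeo X).
Implicit Types (f g h s : homeo X) (x y z : X) (W : set X).

Lemma homeo_orbit_refl x : homeo_orbit phi x x.
Proof. by exists 0%R. Qed.

Lemma homeo_orbit_sym x y : homeo_orbit phi x y -> homeo_orbit phi y x.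
Proof. by case=> n _ <-; exists (- n)%R => //; rewrite expgzN homeoK. Qed.

Lemma homeo_orbit_trans x y z :
  homeo_orbit phi x y -> homeo_orbit phi y z -> homeo_orbit phi x z.
Proof.
by case=> n _ <- [m _ <-]; exists (m + n)%R => //; rewrite expgzD homeoM.
Qed.

Lemma full_group_subgroup : is_subgroup (full_group phi).
Proof.
split=> [x|f g Ff Fg x|f Ff x]; first exact: homeo_orbit_refl.
  exact: homeo_orbit_trans (Fg x) (Ff (g x)).
by have := Ff (f^-1 x); rewrite homeoVK => /homeo_orbit_sym.
Qed.

Lemma full_group_swap h W s :
  full_group phi h -> is_swap h W s -> full_group phi s.
Proof.
move=> Fh [s1 s2 s3] x; have [Wx|nWx] := pselect (W x); first by rewrite s1.
have [Whx|nWhx] := pselect (W (h^-1 x)); last by rewrite s3 //; exists 0%R.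
rewrite -[x in s x](homeoVK h) s2 //.
by have [_ _ FV] := full_group_subgroup; exact: FV.
Qed.

Definition locally_power f :=
  forall x, exists n : int, \forall y \near x, f y = expgz phi n y.

Lemma locally_power_expgz n : locally_power (expgz phi n).
Proof. by move=> x; exists n; exact: nearW. Qed.

Lemma locally_power_subgroup : is_subgroup locally_power.
Proof.
split=> [|f g Lf Lg x|f Lf x]; first exact: (locally_power_expgz 0).
  have [n gn] := Lg x; have [m fm] := Lf (g x).
  exists (m + n)%R; apply: filterS2 gn (homeo_near fm) => y gy fy.
  by rewrite homeoM fy gy expgzD.
have [n fn] := Lf (f^-1 x); exists (- n)%R.
apply: filterS (homeo_near fn) => y fy.
by rewrite expgzN -[y in RHS](homeoVK f) [in RHS]fy homeoK.
Qed.

Lemma locally_power_swap h W s :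
  clopen W -> locally_power h -> is_swap h W s -> locally_power s.
Proof.
move=> cW Lh [s1 s2 s3] x; have [_ _ LV] := locally_power_subgroup.
have [Wx|nWx] := pselect (W x).
  have [n hn] := Lh x; exists n.
  by apply: filterS2 hn (clopen_near cW Wx) => y <- /s1.
have cWh := preimage_homeo_clopen h^-1 cW.
have [Whx|nWhx] := pselect (W (h^-1 x)).
  have [n hn] := LV h Lh x; exists n.
  by apply: filterS2 hn (clopen_near cWh Whx) => y <- /s2; rewrite homeoVK.
exists 0%R; apply: filterS2 (clopen_nearC cW nWx) (clopen_nearC cWh nWhx).
by move=> y ? ?; rewrite s3.
Qed.

(** Where phi has no periodic point the cocycle is unique, so that a local
    choice of exponents is automatically coherent. *)
Lemma topological_full_groupE :
    (forall x (m n : int), expgz phi m x = expgz phi n x -> m = n) ->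
  topological_full_group phi = locally_power.
Proof.
move=> aper; apply/seteqP; split=> f /=.
  move=> [_ [n [fn cn]]] x; exists (n x).
  have nx : \forall y \near x, n y = n x by move/discrete_cvg: (cn x); apply.
  by apply: filterS nx => y ny; rewrite -ny; exact: fn.
move=> Lf; have /choice[n fn] := Lf.
split=> [x|]; first by exists (n x) => //; rewrite (nbhs_singleton (fn x)).
exists n; split=> [x|x]; first exact: nbhs_singleton (fn x).
apply/discrete_cvg; apply: filterS (fn x) => y fy /=.
by apply: (aper y); rewrite -fy (nbhs_singleton (fn y)).
Qed.

(** The properties of the full group and of the topological full group through
    which the theorem is proved for both at once. *)
Record full_group_like (K : set (homeo X)) : Prop := FullGroupLike {
  fgl_subgroup : is_subgroup K;
  fgl_topological : topological_full_group phi `<=` K;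
  fgl_full : K `<=` full_group phi;
  fgl_swap : forall h W s, K h -> clopen W -> is_swap h W s -> K s
}.

End FullGroups.

(** * Invariant means *)

Lemma finite_subcover (X : topologicalType) (I : eqType) (U : I -> set X) :
    compact [set: X] -> (forall i, open (U i)) -> (forall x, exists i, U i x) ->
  exists s : seq I, forall x, exists2 i, i \in s & U i x.
Proof.
move=> /compact_near_coveringP cX oU covU.
pose F := filter_from [set: seq I] (fun s => [set t : seq I | {subset s <= t}]).
have FF : Filter F.
  apply: filter_from_filter; first by exists [::].
  move=> s t _ _; exists (s ++ t) => // r /= sub.
  by split=> i si; apply: sub; rewrite mem_cat si ?orbT.
have /= := cX _ F (fun s x => exists2 i, i \in s & U i x) FF.
case=> [x _|s _ sP].
  have [i Uix] := covU x; exists (U i, [set t : seq I | i \in t]) => /=.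
    by split; [exact: open_nbhs_nbhs|exists [:: i] => // t /=; apply; rewrite mem_head].
  by case=> y t /= [Uiy it]; exists i.
by exists s => x; exact: (sP s).
Qed.

Section Means.
Variables (R : realType) (X : topologicalType) (phi : homeo X).
Implicit Types (mu : set X -> R) (A B C : set X) (x : X).
Local Open Scope ring_scope.

(** Means are taken on all sets rather than on the clopen algebra, which spares
    side conditions; the part of countable additivity that matters is recovered
    from compactness in full_group_mean_le. *)
Record invariant_mean mu : Prop := InvariantMean {
  mean_ge0 : forall A, 0 <= mu A;
  mean_setT : mu setT = 1;
  meanU : forall A B, A `&` B = set0 -> mu (A `|` B) = mu A + mu B;
  mean_shift : forall A, mu (phi @^-1` A) = mu A
}.

Section MeanTheory.
Variable mu : set X -> R.
Hypothesis mu_mean : invariant_mean mu.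

Lemma mean_split A B : mu A = mu (A `&` B) + mu (A `\` B).
Proof.
rewrite -(meanU mu_mean) ?setUIDK //.
by apply/seteqP; split=> x //= [[_ Bx] [_ /(_ Bx)]].
Qed.

Lemma mean_le A B : A `<=` B -> mu A <= mu B.
Proof.
move=> /setIidPr AB; rewrite (mean_split B A) AB lerDl.
exact: mean_ge0.
Qed.

Lemma meanU_le A B : mu (A `|` B) <= mu A + mu B.
Proof.
rewrite (mean_split _ A) setUK setDUl setDv set0U lerD2l.
by apply: mean_le => x [].
Qed.

Lemma mean_setC A : mu (~` A) = 1 - mu A.
Proof. by rewrite -(mean_setT mu_mean) (mean_split setT A) setTI setTD addrC addKr. Qed.

Lemma meanD_ge A B : mu A - mu B <= mu (A `\` B).
Proof.
rewrite lerBlDl (mean_split A B) lerD2r; apply: mean_le; exact: subIsetr.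
Qed.

Lemma mean_expgz (n : int) A : mu (expgz phi n @^-1` A) = mu A.
Proof.
elim/int_ind: n A => [A|n IH A|n IH A].
- by [].
- have -> : n.+1%:Z = 1 + n%:Z by lia.
  by rewrite expgzS -[RHS](mean_shift mu_mean) -[RHS]IH.
- have -> : - n.+1%:Z = - n%:Z - 1 by lia.
  rewrite expgzP; transitivity (mu ((phi^-1)%g @^-1` A)); first exact: IH.
  by rewrite -(mean_shift mu_mean) preimage_homeoK.
Qed.

Lemma mean_bigcup_le (I : eqType) (s : seq I) (F : I -> set X) (c : R) A :
    (forall i, mu (F i) <= c) -> (forall x, A x -> exists2 i, i \in s & F i x) ->
  mu A <= (size s)%:R * c.
Proof.
move=> Fc; elim: s A => [|i s IH] A cov.
  rewrite mul0r; have -> : A = set0 by apply/seteqP; split=> x // /cov[].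
  by have := meanU mu_mean (setI0 set0); rewrite setU0; lra.
rewrite (mean_split A (F i)) /= -natr1 mulrDl mul1r addrC lerD //.
  apply: IH => x [Ax nFx]; have [j] := cov x Ax.
  by rewrite inE => /predU1P[-> //|js Fjx]; exists j.
by apply: le_trans (Fc i); apply: mean_le; exact: subIsetr.
Qed.

Lemma mean_disjoint_translates (k : nat) C :
    (forall i j : nat, (i < j < k)%N ->
      expgz phi i @^-1` C `&` expgz phi j @^-1` C = set0) ->
  k%:R * mu C <= 1.
Proof.
move=> dis; pose D m := [set x | exists2 i : nat, (i < m)%N & C (expgz phi i x)].
suff muD m : (m <= k)%N -> mu (D m) = m%:R * mu C.
  by rewrite -muD // -(mean_setT mu_mean); apply: mean_le.
elim: m => [_|m IH mk].
  rewrite mul0r; have -> : D 0%N = set0 by apply/seteqP; split=> x // [].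
  by have := meanU mu_mean (setI0 set0); rewrite setU0; lra.
have -> : D m.+1 = D m `|` expgz phi m @^-1` C.
  apply/seteqP; split=> x.
    by case=> i; rewrite ltnS leq_eqVlt => /predU1P[->|im] Ci; [right|left; exists i].
  by case=> [[i im Ci]|Cm]; [exists i => //; lia|exists m].
rewrite (meanU mu_mean) ?IH ?mean_expgz; [|lia|].
  by rewrite -natr1 mulrDl mul1r.
apply/seteqP; split=> x // [[i im Ci] Cm].
by rewrite -(dis i m) //; apply/andP.
Qed.

End MeanTheory.

(** Elements of the full group preserve the measure of clopen sets although
    their cocycle may take infinitely many values: the level set of f on which
    f is the n-th power of phi has a clopen neighbourhood O_n that it fills up
    to an error as small as desired, so that f shrinks no clopen subset of O_n
    by more than that; finitely many O_n cover X. *)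
Lemma full_group_mean_le mu f C :
    compact [set: X] -> invariant_mean mu -> full_group phi f -> clopen C ->
  mu C <= mu ((f^-1)%g @^-1` C).
Proof.
move=> cX mum Ff cC; rewrite leNgt; apply/negP => lt_fC.
pose e := mu C - mu ((f^-1)%g @^-1` C).
have e0 : 0 < e by rewrite subr_gt0.
pose g k : homeo X := if unpickle k is Some n then expgz phi n else 1%g.
have mug k A : mu (g k @^-1` A) = mu A.
  by rewrite /g; case: unpickle => [n|//]; exact: mean_expgz.
(* optimality of a clopen neighbourhood O of the set where f = g k *)
pose tight k O := clopen O /\ forall Q, clopen Q ->
  (forall x, f x = g k x -> Q x) -> mu O <= mu Q + e / 2 ^+ k.+1.
have /choice[O OP] k : exists O, tight k O /\ forall x, f x = g k x -> O x.
  pose E := [set mu Q | Q in [set Q | clopen Q /\ forall x, f x = g k x -> Q x]].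
  have infE : has_inf E.
    split; first by exists (mu setT); exists setT => //; split => //; exact: clopenT.
    by exists 0 => _ [Q _ <-]; exact: mean_ge0.
  have ek : 0 < e / 2 ^+ k.+1 by rewrite divr_gt0 ?exprn_gt0.
  have [_ [O [cO WO] <-] ltO] := inf_adherent ek infE.
  exists O; split=> //; split=> // Q cQ WQ; apply: ltW (lt_le_trans ltO _).
  by rewrite lerD2r; apply: (ge_inf infE.2); exists Q.
have loss k D : clopen D -> D `<=` O k ->
    mu D <= mu ((f^-1)%g @^-1` D) + e / 2 ^+ k.+1.
  move=> cD DO; have [[cO tO] WO] := OP k.
  pose Q := g k @^-1` ((f^-1)%g @^-1` D) `|` (O k `\` D).
  have cQ : clopen Q.
    apply: clopenU; last exact: clopenD.
    by do 2!apply: preimage_homeo_clopen.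
  have WQ x : f x = g k x -> Q x.
    move=> fx; have [Dx|nDx] := pselect (D x); last by right; split=> //; exact: WO.
    by left; rewrite /preimage /mkset -fx homeoK.
  have := tO Q cQ WQ.
  have := meanU_le mum (g k @^-1` ((f^-1)%g @^-1` D)) (O k `\` D).
  rewrite mug -/Q; have := mean_split mum (O k) D.
  by move/setIidPr: DO => ->; lra.
have [s scov] : exists s : seq nat, forall x, exists2 k, k \in s & O k x.
  apply: finite_subcover => // [k|x]; first by have [[[]]] := OP k.
  have [n _ nx] := Ff x; exists (pickle n); have [_] := OP (pickle n); apply.
  by rewrite /g pickleK nx.
have bound m D : clopen D -> (forall x, D x -> exists2 k, (k < m)%N & O k x) ->
    mu D <= mu ((f^-1)%g @^-1` D) + e * (1 - (2 ^+ m)^-1).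
  elim: m D => [|m IH] D cD cov.
    rewrite expr0 invr1 subrr mulr0 addr0.
    have -> : D = set0 by apply/seteqP; split=> x // /cov[].
    by apply: mean_le mum _ _ _.
  have [[cO _] _] := OP m.
  have := loss m (D `&` O m) (clopenI cD cO) (@subIsetr _ _ _).
  have /IH : clopen (D `\` O m) by exact: clopenD.
  have cov' x : (D `\` O m) x -> exists2 k, (k < m)%N & O k x.
    case=> Dx nOx; have [k] := cov x Dx.
    by rewrite ltnS leq_eqVlt => /predU1P[->|km Okx] //; exists k.
  move/(_ cov'); have := mean_split mum D (O m).
  have -> : mu ((f^-1)%g @^-1` D) = mu ((f^-1)%g @^-1` (D `&` O m))
      + mu ((f^-1)%g @^-1` (D `\` O m)) by exact: (mean_split mum).
  move=> ->.
  have -> : (2 ^+ m : R)^-1 = 2 * (2 ^+ m.+1)^-1.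
    by rewrite exprS invfM mulVKf // pnatr_eq0.
  lra.
pose M := (\max_(k <- s) k).+1.
have covM x : C x -> exists2 k, (k < M)%N & O k x.
  by have [k ks Okx] := scov x; exists k => //; rewrite ltnS; exact: leq_bigmax_seq.
have := bound M C cC covM; apply/negP; rewrite -ltNge -ltrBrDl -/e.
by rewrite gtr_pMr // ltrBlDr ltrDl invr_gt0 exprn_gt0.
Qed.

Lemma full_group_mean mu f C :
    compact [set: X] -> invariant_mean mu -> full_group phi f -> clopen C ->
  mu (f @^-1` C) = mu C.
Proof.
move=> cX mum Ff cC; apply/eqP; rewrite eq_le; apply/andP; split.
  have := full_group_mean_le cX mum Ff (preimage_homeo_clopen f cC).
  by rewrite -{1}[f]invgK preimage_homeoK.
have [_ _ FV] := full_group_subgroup phi.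
by have := full_group_mean_le cX mum (FV _ Ff) cC; rewrite invgK.
Qed.



Definition visits A x N : nat := \sum_(i < N) `[< A ((phi ^+ i)%g x) >].

(** The frequency of visits along a window of length N + 1 is additive, and
    changes by at most 1 / (N + 1) under a shift of the window. *)
Lemma visits_ultralimit (x : nat -> X) :
  exists2 mu, invariant_mean mu &
    forall A B, (forall N, visits B (x N) N.+1 <= visits A (x N) N.+1)%N ->
      mu B <= mu A.
Proof.
have [U [UU sub]] := @ultraFilterLemma _ \oo _.
pose a A N : R := (visits A (x N) N.+1)%:R / N.+1%:R.
have a01 A N : `[0, 1]%classic (a A N).
  rewrite /= in_itv /= divr_ge0 //= ler_pdivrMr ?ltr0n // mul1r ler_nat.
  rewrite -[leqRHS]card_ord -sum1_card; apply: leq_sum => i _.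
  by case: `[< _ >].
have /choice[mu cvga] : forall A, exists l : R, a A @ U --> l.
  move=> A; have [] := @segment_compact R 0 1 (a A @ U).
    by apply: (@filterS _ U _ setT) => [N _|]; [exact: a01|exact: filterT].
  move=> l [_ cl_l]; exists l => V Vl.
  have [//|UV] := in_ultra_setVsetC (a A @^-1` V) UU.
  by have [z [nVz Vz]] := cl_l (~` V) V UV Vl.
have harm : (fun N => N.+1%:R^-1 : R) @ U --> (0 : R).
  by apply: cvg_trans (@cvg_harmonic R) => V /sub.
have mu_le A B : (forall N, a B N <= a A N + N.+1%:R^-1) -> mu B <= mu A.
  move=> BA; rewrite -[leRHS]addr0.
  by apply: (ler_cvg_to (cvga B) (cvgD (cvga A) harm)); exact: nearW.
exists mu; last first.
  move=> A B BA; apply: mu_le => N; apply: (@le_trans _ _ (a A N)).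
    by rewrite ler_pM2r ?invr_gt0 ?ltr0n // ler_nat.
  by rewrite lerDl invr_ge0.
have shift A y N : (visits (phi @^-1` A) y N + `[< A y >]
    = visits A y N + `[< A ((phi ^+ N)%g y) >])%N.
  transitivity (visits A y N.+1); last by rewrite /visits big_ord_recr.
  rewrite /visits big_ord_recl /= addnC; congr addn.
  by apply: eq_bigr => i _; rewrite /bump /= add1n expgS.
have mu_lim A l : a A @ U --> l -> mu A = l.
  move=> al; rewrite -(cvg_lim (@norm_hausdorff _ _) (cvga A)).
  exact: cvg_lim al.
split.
- move=> A; have a0 N : 0 <= a A N by have := a01 A N; rewrite /= in_itv => /andP[].
  by apply: (ler_cvg_to (cvg_cst (0 : R)) (cvga A)); exact: nearW.
- apply: mu_lim; suff -> : a setT = cst (1 : R) by exact: cvg_cst.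
  apply/funext => N.
  rewrite /a /visits; under eq_bigr do rewrite asboolT //.
  by rewrite sum1_card card_ord divff // pnatr_eq0.
- move=> A B AB; apply: mu_lim.
  suff -> : a (A `|` B) = a A \+ a B by exact: cvgD.
  apply/funext => N; rewrite /a /visits /= -mulrDl -natrD -big_split /=; congr (_%:R * _).
  apply: eq_bigr => i _; rewrite asbool_or; move: ((phi ^+ i)%g (x N)) => y.
  have [Ay|nAy] := asboolP (A y); have [By|nBy] := asboolP (B y) => //.
  by suff : (A `&` B) y by rewrite AB.
- have le_incr N m n : (m <= n.+1)%N ->
      m%:R / N.+1%:R <= n%:R / N.+1%:R + N.+1%:R^-1 :> R.
    move=> mn; rewrite -[X in _ + X]mul1r -mulrDl natr1.
    by rewrite ler_pM2r ?invr_gt0 ?ltr0n // ler_nat.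
  move=> A; apply/eqP; rewrite eq_le; apply/andP; split; apply: mu_le => N;
    apply: le_incr; have := shift A (x N) N.+1;
    have := leq_b1 `[< A (x N) >]; have := leq_b1 `[< A ((phi ^+ N.+1)%g (x N)) >];
    lia.
Qed.

End Means.

(** * Comparison of clopen sets *)

Section Matching.
Variables (X : topologicalType) (phi : homeo X) (A B : set X).
Hypotheses (cA : clopen A) (cB : clopen B) (AB0 : A `&` B = set0).
Implicit Types (x y : X) (i j m n : nat).

(** The points of A and of B left after n stages of a greedy matching along the
    orbits, in which stage n matches x with phi^n x whenever both are free. *)
Fixpoint unmatched n : set X * set X :=
  if n is n'.+1 then
    let U := unmatched n' in
    let M := U.1 `&` (phi ^+ n')%g @^-1` U.2 in
    (U.1 `\` M, U.2 `\` (phi ^- n')%g @^-1` M)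
  else (A, B).

Definition matched n := (unmatched n).1 `&` (phi ^+ n)%g @^-1` (unmatched n).2.

Lemma unmatchedS n : unmatched n.+1 =
  ((unmatched n).1 `\` matched n, (unmatched n).2 `\` (phi ^- n)%g @^-1` matched n).
Proof. by []. Qed.

Lemma unmatched_clopen n : clopen (unmatched n).1 /\ clopen (unmatched n).2.
Proof.
elim: n => [//|n [c1 c2]]; rewrite unmatchedS.
have cM : clopen (matched n) by apply: clopenI => //; exact: preimage_homeo_clopen.
by split; apply: clopenD => //; exact: preimage_homeo_clopen.
Qed.

Lemma matched_clopen n : clopen (matched n).
Proof.
have [c1 c2] := unmatched_clopen n.
by apply: clopenI => //; exact: preimage_homeo_clopen.
Qed.

Lemma unmatched_sub m n : (m <= n)%N ->
  (unmatched n).1 `<=` (unmatched m).1 /\ (unmatched n).2 `<=` (unmatched m).2.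
Proof.
elim: n => [|n IH]; first by rewrite leqn0 => /eqP ->; split=> x.
rewrite leq_eqVlt => /predU1P[->|/IH[s1 s2]]; first by split=> x.
by split=> x; rewrite unmatchedS => -[]; [move/s1|move/s2].
Qed.

Lemma unmatched_subA n : (unmatched n).1 `<=` A.
Proof. exact: (unmatched_sub (leq0n n)).1. Qed.

Lemma unmatched_subB n : (unmatched n).2 `<=` B.
Proof. exact: (unmatched_sub (leq0n n)).2. Qed.

Lemma not_AB x : A x -> ~ B x.
Proof. by move=> Ax Bx; have : (A `&` B) x by []; rewrite AB0. Qed.

Lemma unmatched1P n x : (unmatched n).1 x -> forall j, (j < n)%N -> ~ matched j x.
Proof. by move=> Ux j jn Mx; have [/(_ x Ux)[]] := unmatched_sub jn. Qed.

Lemma unmatched2P n y : B y -> ~ (unmatched n).2 y ->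
  exists2 j, (j < n)%N & matched j ((phi ^- j)%g y).
Proof.
move=> By; elim: n => [//|n IH] nUy.
have [Uy|/IH[j jn Mj]] := pselect ((unmatched n).2 y); last by exists j => //; exact: leqW.
by exists n => //; apply: contrapT => nM; apply: nUy.
Qed.

Lemma matched_inj i j x : matched i x -> matched j x -> i = j.
Proof.
move=> Mi Mj; have [ij|ji|//] := ltngtP i j.
  by have := unmatched1P Mj.1 ij.
by have := unmatched1P Mi.1 ji.
Qed.

(** While a point x of A is unmatched, every point of B that its orbit meets in
    time less than n is matched with a point of A visited in between: a point
    of A before x is farther away, and x would have been preferred. *)
Lemma unmatched_visits n x : (unmatched n).1 x ->
  (visits phi B x n <= visits phi A x n)%N.
Proof.
case: n => [|n] Ux; first by rewrite /visits !big_ord0.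
have mate (i : 'I_n.+1) : exists m : 'I_n.+1, B ((phi ^+ i)%g x) ->
    A ((phi ^+ m)%g x) /\ matched (i - m) ((phi ^+ m)%g x) /\ (m <= i)%N.
  have [Bi|nBi] := pselect (B ((phi ^+ i)%g x)); last by exists i.
  have nUi : ~ (unmatched i).2 ((phi ^+ i)%g x).
    move=> Ui; apply: (unmatched1P Ux (ltn_ord i)); split=> //.
    by apply: (unmatched_sub (ltnW (ltn_ord i))).1.
  have [j ji Mj] := unmatched2P Bi nUi.
  have im : (i - j < n.+1)%N by apply: leq_ltn_trans (leq_subr _ _) _.
  exists (Ordinal im) => _ /=.
  have <- : (phi ^- j)%g ((phi ^+ i)%g x) = (phi ^+ (i - j))%g x.
    by rewrite -{1}(subnK (ltnW ji)) addnC expgnDr homeoM homeoK.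
  rewrite subKn ?(ltnW ji) //; split; last by split=> //; exact: leq_subr.
  exact: unmatched_subA Mj.1.
have [m mP] := choice mate.
pose SA := [set i : 'I_n.+1 | `[< A ((phi ^+ i)%g x) >]]%SET.
pose SB := [set i : 'I_n.+1 | `[< B ((phi ^+ i)%g x) >]]%SET.
have visitsE C : visits phi C x n.+1 =
    #|[set i : 'I_n.+1 | `[< C ((phi ^+ i)%g x) >]]%SET|.
  rewrite /visits -sum1_card [RHS]big_mkcond /=.
  by apply: eq_bigr => i _; rewrite inE; case: `[< _ >].
rewrite !visitsE -/SA -/SB -(@card_in_imset _ _ m SB).
  apply: subset_leq_card; apply/fintype.subsetP => _ /imsetP[i + ->].
  by rewrite !inE => /mP[].
move=> i j; rewrite !inE => /mP[_ [Mi mi]] /mP[_ [Mj mj]] mij.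
apply: val_inj => /=; rewrite -(subnK mi) -(subnK mj) -mij; congr (_ + _)%N.
by apply: matched_inj Mi _; rewrite mij.
Qed.

(** The product of the swaps performed at the first n stages; their supports are
    disjoint, so each of them acts as if it were alone. *)
Lemma matching_swaps n : exists alpha : homeo X,
  [/\ locally_power phi alpha,
      forall x, A x -> ~ (unmatched n).1 x ->
        B (alpha x) /\ ~ (unmatched n).2 (alpha x),
      forall x, (unmatched n).1 x \/ (unmatched n).2 x -> alpha x = x,
      forall x, ~ A x -> ~ A (alpha x) -> alpha x = x &
      forall x, ~ A x -> ~ B x -> alpha x = x].
Proof.
elim: n => [|n [a [La aA aU anA anAB]]].
  by exists 1%g; split=> //; have [] := locally_power_subgroup phi.
have MA x : matched n x -> A x by move=> [/unmatched_subA].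
have MB x : matched n x -> (unmatched n).2 ((phi ^+ n)%g x) by case.
have VMB x : matched n ((phi ^- n)%g x) -> (unmatched n).2 x.
  by move/MB; rewrite homeoVK.
have [|t ts] := @swap_exists _ (phi ^+ n)%g _ (matched_clopen n).
  by move=> x /MB/unmatched_subB Bx /MA/not_AB.
have Lt : locally_power phi t.
  apply: locally_power_swap (matched_clopen n) _ ts.
  exact: (locally_power_expgz phi n).
have [t1 t2 t3] := ts.
have [_ LM _] := locally_power_subgroup phi.
exists (t * a)%g; split; first exact: LM.
- move=> x Ax; rewrite unmatchedS homeoM => nUx.
  have [Ux|nU] := pselect ((unmatched n).1 x).
    have Mx : matched n x by apply: contrapT => nMx; apply: nUx.
    rewrite aU; last by left.
    rewrite t1 //; split; first exact: unmatched_subB (MB _ Mx).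
    by case=> _; apply; rewrite /preimage /mkset homeoK.
  have [Bax nUax] := aA x Ax nU.
  rewrite t3; [by split=> // -[]| |by move/VMB].
  by move/MA/not_AB.
- move=> x; rewrite unmatchedS homeoM /= => Ux.
  rewrite aU; last by case: Ux => -[]; [left|right].
  apply: t3; case: Ux => -[Ux] nM //.
    by move/MA/not_AB; apply; exact: unmatched_subB Ux.
  by move/VMB/unmatched_subB; apply: not_AB; exact: unmatched_subA Ux.
- move=> x nAx; rewrite homeoM => nAt.
  have [Max|nMax] := pselect (matched n (a x)).
    have /homeo_inj axx : a (a x) = a x by apply: aU; left; case: Max.
    by case: nAx; rewrite -axx; exact: MA.
  have [Vax|nVax] := pselect (matched n ((phi ^- n)%g (a x))).
    by case: nAt; rewrite -[a x](homeoVK (phi ^+ n)%g) t2 //; exact: MA.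
  by rewrite t3 // in nAt *; exact: anA.
- move=> x nAx nBx; rewrite homeoM anAB // t3 //; first by move/MA.
  by move/VMB/unmatched_subB.
Qed.

End Matching.

(** If the greedy matching never ended, points left unmatched for longer and
    longer would have orbit statistics that converge to a mean for which A is at
    least as large as B. *)
Lemma clopen_comparison (R : realType) (X : topologicalType) (phi : homeo X)
    (A B : set X) :
    clopen A -> clopen B ->
    (forall mu : set X -> R, invariant_mean phi mu -> (mu A < mu B)%R) ->
  exists alpha : homeo X,
    [/\ locally_power phi alpha, forall x, A x -> B (alpha x) &
        forall x, ~ A x -> ~ A (alpha x) -> alpha x = x].
Proof.
move=> cA cB ltAB.
have cAB : clopen (A `\` B) by exact: clopenD.
have cBA : clopen (B `\` A) by exact: clopenD.
have dis : (A `\` B) `&` (B `\` A) = set0 by apply/seteqP; split=> x // [[_ ?] []].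
have [n Un0] : exists n, (unmatched phi (A `\` B) (B `\` A) n).1 = set0.
  apply: contrapT => /forallNP Un.
  have /choice[x xU] : forall n, exists y : X,
      (unmatched phi (A `\` B) (B `\` A) n.+1).1 y.
    by move=> n; apply/set0P/eqP.
  have [mu mum /(_ (A `\` B) (B `\` A))] := @visits_ultralimit R X phi x.
  have := ltAB mu mum; rewrite (mean_split mum A B) (mean_split mum B A) setIC.
  rewrite ltrD2l ltNge => /negP nle /(_ _)/nle; apply=> n.
  exact: unmatched_visits (xU n).
have [a [La aA aU anA anAB]] := matching_swaps phi cAB cBA dis n.
exists a; split=> // x.
  move=> Ax; have [Bx|nBx] := pselect (B x); first by rewrite anAB // => -[].
  by have [|[]] := aA x (conj Ax nBx) _; first by rewrite Un0.
by move=> nAx nAax; apply: anA => -[].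
Qed.

(** * Cantor minimal systems *)

Section CantorMinimal.
Variables (R : realType) (X : metricType R) (phi : homeo X).
Hypothesis hphi : cantor_minimal_system phi.
Implicit Types (f g h s : homeo X) (x y z : X) (A B C U W : set X).
Implicit Types mu : set X -> R.
Local Open Scope ring_scope.

Let compactX : compact [set: X]. Proof. by case: hphi => -[]. Qed.

Lemma clopen_separation x y : x <> y -> exists U, [/\ clopen U, U x & ~ U y].
Proof. by case: hphi => -[_ _ zX _] _ /eqP; exact: zX. Qed.

(** A periodic orbit is finite, hence closed, so density makes it all of X and
    its points isolated. *)
Lemma minimal_no_period (k : nat) x : (phi ^+ k.+1)%g x <> x.
Proof.
move=> phikx; pose P : set X := [set (phi ^+ i)%g x | i in `I_k.+1].
have finP : finite_set P by apply: finite_image; exact: finite_II.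
have closed_finite (A : set X) : finite_set A -> closed A.
  by move: A; apply/accessible_finite_set_closed/hausdorff_accessible/metric_hausdorff.
have Pphi y : P y -> P (phi y).
  move=> [i /= ik <-]; rewrite -homeoM -expgS; move: ik.
  rewrite ltnS leq_eqVlt => /predU1P[->|ik]; last by exists i.+1.
  by rewrite phikx; exists 0%N.
have PphiV y : P y -> P ((phi^-1)%g y).
  move=> [[|i] ik <-]; last by rewrite expgS homeoM homeoK; exists i => //; exact: ltnW.
  by rewrite -{1}phikx expgS homeoM homeoK; exists k => /=.
have Px : P x by exists 0%N.
have orbP (n : int) : P (expgz phi n x).
  elim/int_ind: n => [//|n IH|n IH].
    have -> : n.+1%:Z = 1 + n%:Z by lia.
    by rewrite expgzS; exact: Pphi.
  have -> : - n.+1%:Z = - n%:Z - 1 by lia.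
  by rewrite expgzP; exact: PphiV.
have PT : P = setT.
  apply/seteqP; split=> // y _; apply: contrapT => nPy.
  have [_ /(_ x (~` P))] := hphi; case; first by exists y.
    by apply: closed_openC; exact: closed_finite.
  by move=> z [nPz [n _ nz]]; apply: nPz; rewrite -nz.
have : isolated [set: X] x.
  split; first by rewrite inE.
  exists [set x]; last by rewrite setIT.
  apply: open_nbhs_nbhs; split=> //.
  rewrite -[X in open X]setCK; apply: closed_openC; apply: closed_finite.
  by apply: sub_finite_set finP; rewrite PT.
have isoT0 : isolated [set: X] = set0 by case: hphi => -[].
by rewrite isoT0.
Qed.

Lemma minimal_aperiodic x (m n : int) : expgz phi m x = expgz phi n x -> m = n.
Proof.
have fwd (k : nat) y : expgz phi k.+1%:Z y <> y by exact: minimal_no_period.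
have wlog_lt (i j : int) : i < j -> expgz phi i x <> expgz phi j x.
  move=> ij; have -> : j = (absz (j - i - 1)%R).+1%:Z + i by lia.
  by rewrite expgzD homeoM => /esym; exact: fwd.
by move=> mn; have [/wlog_lt/(_ mn)|/wlog_lt/(_ (esym mn))|] := ltgtP m n.
Qed.

(** A neighbourhood of x whose first k translates are disjoint has mean at most
    1 / k; it exists because x is not periodic. *)
Lemma small_clopen (e : R) x : 0 < e -> exists W,
  [/\ clopen W, W x & forall mu, invariant_mean phi mu -> mu W < e].
Proof.
move=> e0; pose k := (Num.truncn e^-1).+1.
have ke : 1 < k%:R * e.
  by rewrite -ltr_pdivrMr // div1r; exact: truncnS_gt.
have [W [cW Wx Wdis]] : exists W, [/\ clopen W, W x &
    forall i : nat, (0 < i < k)%N -> forall y, W y -> ~ W (expgz phi i y)].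
  elim: k {ke} => [|k [W [cW Wx Wdis]]].
    by exists setT; split=> // [|i]; [exact: clopenT|case/andP].
  have [k0|k0] := posnP k; first by exists W; split=> // i; lia.
  have [|V [cV Vx nVx]] := @clopen_separation x (expgz phi k x).
    by move/(@minimal_aperiodic x 0); lia.
  exists (W `&` (V `\` expgz phi k @^-1` V)); split=> //.
    by apply: clopenI => //; apply: clopenD => //; exact: preimage_homeo_clopen.
  move=> i /andP[i0]; rewrite ltnS leq_eqVlt.
  move=> /predU1P[->|ik] y [Wy [Vy nVy]] [Wiy [Viy _]] //.
  by apply: (Wdis i _ y) => //; rewrite i0.
exists W; split=> // mu mum.
have : k%:R * mu W <= 1.
  apply: (mean_disjoint_translates mum) => i j /andP[ij jk].
  apply/seteqP; split=> y // [Wi Wj]; apply: (Wdis (j - i)%N _ _ Wi); first by lia.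
  by rewrite -homeoM -expgzD; have <- : j%:Z = (j - i)%N%:Z + i%:Z by lia.
move=> kW; rewrite ltNge; apply/negP => eW.
by have := ler_wpM2l (ler0n R k) eW; lra.
Qed.

(** By minimality and compactness finitely many translates of U cover X. *)
Lemma clopen_mean_lower_bound U x : clopen U -> U x -> exists d : R,
  [/\ 0 < d, d <= 1 & forall mu, invariant_mean phi mu -> d <= mu U].
Proof.
move=> cU Ux.
have [s sP] : exists s : seq int,
    forall y, exists2 n, n \in s & U (expgz phi n y).
  apply: finite_subcover => // [n|y]; first by case: (preimage_homeo_clopen (expgz phi n) cU).
  have [_ /(_ y U)] := hphi; case; [by exists x|by case: cU|].
  by move=> z [Uz [n _ nz]]; exists n; rewrite nz.
exists (size s).+1%:R^-1; split; rewrite ?invr_gt0 ?ltr0n //.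
  by rewrite invf_le1 ?ltr0n // ler1n.
move=> mu mum; have : mu setT <= (size s)%:R * mu U.
  apply: (mean_bigcup_le mum (F := fun n => expgz phi n @^-1` U)).
    by move=> n; rewrite (mean_expgz mum).
  by move=> y _; exact: sP.
rewrite (mean_setT mum) => sU.
rewrite -div1r ler_pdivrMr ?ltr0n // -natr1 mulrDr mulr1 mulrC.
by have := mean_ge0 mum U; lra.
Qed.

Lemma displaced_clopen h : h <> 1%g -> exists U x,
  [/\ clopen U, U x & forall y, U y -> ~ U (h y)].
Proof.
move=> h1; have [x hx] : exists x, h x <> x.
  apply: contrapT => /forallNP hx; apply: h1; apply: homeo_ext => x.
  exact: contrapT (hx x).
have [V [cV Vx nVx]] := clopen_separation (nesym hx).
exists (V `\` h @^-1` V), x; split=> //; last by move=> y [_ nVy] [].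
by apply: clopenD => //; exact: preimage_homeo_clopen.
Qed.

Lemma topological_full_group_local :
  topological_full_group phi = locally_power phi.
Proof. exact: topological_full_groupE minimal_aperiodic. Qed.

Lemma full_group_is_full_group_like : full_group_like phi (full_group phi).
Proof.
split=> //; first exact: full_group_subgroup; first by move=> f [].
by move=> h W s Fh _; exact: full_group_swap.
Qed.

Lemma topological_full_group_is_full_group_like :
  full_group_like phi (topological_full_group phi).
Proof.
split=> //; last 2 first.
- by move=> f [].
- by move=> h W s; rewrite topological_full_group_local => Lh cW; exact: locally_power_swap.
by rewrite topological_full_group_local; exact: locally_power_subgroup.
Qed.

(** * Elements of small support *)

Section FullGroupLike.
Variable K : set (homeo X).
Hypothesis fglK : full_group_like phi K.

Let sK : is_subgroup K := fgl_subgroup fglK.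
Let K1 : K 1%g. Proof. by case: sK. Qed.
Let KM f g : K f -> K g -> K (f * g)%g. Proof. by case: sK => _ + _; apply. Qed.
Let KV f : K f -> K (f^-1)%g. Proof. by case: sK => _ _; apply. Qed.

Lemma fgl_local f : locally_power phi f -> K f.
Proof. by rewrite -topological_full_group_local; exact: (fgl_topological fglK). Qed.

Lemma fgl_mean mu f C : invariant_mean phi mu -> K f -> clopen C ->
  mu (f @^-1` C) = mu C.
Proof. by move=> mum Kf; exact: (full_group_mean compactX mum (fgl_full fglK Kf)). Qed.

Definition small_support (e : R) s := K s /\ exists C,
  [/\ clopen C, supported C s & forall mu, invariant_mean phi mu -> mu C < e].

(** Conjugation by k transports the support by k, which preserves the mean of
    clopen sets. *)
Lemma small_supportJ e k s : K k -> small_support e s ->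
  small_support e (k * s * k^-1)%g.
Proof.
move=> Kk [Ks [C [cC sC Ce]]]; split; first by apply: KM; [exact: KM|exact: KV].
exists ((k^-1)%g @^-1` C); split.
- exact: preimage_homeo_clopen.
- exact: supportedJ.
- by move=> mu mum; rewrite fgl_mean //; [exact: Ce|exact: KV].
Qed.

(** A swap cannot realise g on W when W and g W overlap; two successive swaps do,
    the first from W to an intermediate set a W disjoint from both. *)
Lemma agree_on_clopen g W (a : homeo X) :
    K g -> K a -> clopen W ->
    (forall x, W x -> ~ W (a x)) ->
    (forall x y, W x -> W y -> g x <> a y) ->
  exists t1 t2, [/\ K t1, K t2,
    supported (W `|` (a^-1)%g @^-1` W) t1,
    supported ((a^-1)%g @^-1` W `|` (g^-1)%g @^-1` W) t2 &
    forall x, W x -> (t2 * t1)%g x = g x].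
Proof.
move=> Kg Ka cW aW gaW; have [t1 ts1] := swap_exists cW aW.
have caW := preimage_homeo_clopen (a^-1)%g cW.
have gaN x : ((a^-1)%g @^-1` W) x -> ~ ((a^-1)%g @^-1` W) ((g * a^-1)%g x).
  move=> Wx Wgx; apply: (gaW _ _ Wx Wgx).
  by rewrite homeoVK homeoM.
have [t2 ts2] := swap_exists caW gaN.
have Kga : K (g * a^-1)%g by apply: KM => //; exact: KV.
exists t1, t2; split; [exact: (fgl_swap fglK) ts1|exact: (fgl_swap fglK) ts2| | |].
- exact: swap_supported.
- apply: supported_sub (swap_supported ts2) => x [|] Wx; [by left|right].
  by move: Wx; rewrite /preimage /mkset invgM invgK homeoM homeoK.
- have [[t1W _ _] [t2W _ _]] := (ts1, ts2).
  move=> x Wx; rewrite homeoM t1W // t2W; first by rewrite homeoM homeoK.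
  by rewrite /preimage /mkset homeoK.
Qed.

(** Dividing f by an element of small support that agrees with it on a small
    clopen set W makes it trivial there; this is repeated along a finite cover
    of X. The intermediate sets used on the way lie in a small reserved set, outside
    which what was achieved earlier is preserved. *)
Lemma full_group_generators (e : R) f : 0 < e -> K f ->
  smallest (@is_subgroup (homeo X)) (small_support e) f.
Proof.
move=> e0 Kf; have [sP1 sPM sPV] := smallest_subgroup (small_support e).
have [x0 _] : [set: X] !=set0 by case: hphi => -[].
(* R0 is left free as room for auxiliary moves, while f is corrected on small
   clopen sets W i covering the rest. *)
have [R0 [cR Rx0 Re]] := small_clopen x0 e0.
have [d [d0 _ dR]] := clopen_mean_lower_bound cR Rx0.
have d3 : 0 < d / 3 by lra.
have /choice[W WP] x := small_clopen x d3.
have [s scov] : exists s : seq X, forall x, exists2 i, i \in s & W i x.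
  apply: finite_subcover => // [i|x]; first by have [[]] := WP i.
  by exists x; have [] := WP x.
suff main (t : seq X) g : K g ->
    (forall x, ~ R0 x -> (forall i, i \in t -> ~ W i x) -> g x = x) ->
    smallest (@is_subgroup (homeo X)) (small_support e) g.
  apply: (main s f Kf) => x _ nWx; have [i si Wix] := scov x.
  by case: (nWx i si).
(* t lists the W i on which g still has to be made trivial *)
elim: t g => [|i t IH] g Kg gfix.
  apply: sub_gen_smallest; split=> //; exists R0; split=> // x nRx; exact: gfix.
have [cW _ We] := WP i.
have cgW := preimage_homeo_clopen (g^-1)%g cW.
have mugW mu : invariant_mean phi mu -> mu ((g^-1)%g @^-1` W i) = mu (W i).
  by move=> mum; apply: fgl_mean => //; exact: KV.
have [|mu mum|a [La aR _]] :=
    clopen_comparison cW (_ : clopen (R0 `\` (W i `|` (g^-1)%g @^-1` W i)))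
      (R := R) (phi := phi).
- by apply: clopenD => //; exact: clopenU.
- have := meanD_ge mum R0 (W i `|` (g^-1)%g @^-1` W i).
  have := meanU_le mum (W i) ((g^-1)%g @^-1` W i).
  by rewrite mugW //; have := dR mu mum; have := We mu mum; lra.
have Ka := fgl_local La.
have muaW mu : invariant_mean phi mu -> mu ((a^-1)%g @^-1` W i) = mu (W i).
  by move=> mum; apply: fgl_mean => //; exact: KV.
have small C B f' : K f' -> clopen C -> clopen B -> supported (C `|` B) f' ->
    (forall mu, invariant_mean phi mu -> mu C = mu (W i) /\ mu B = mu (W i)) ->
    small_support e f'.
  move=> Kf' cC cB sf' CB; split=> //; exists (C `|` B); split=> //; first exact: clopenU.
  move=> mu mum; have [C1 B1] := CB mu mum; have := meanU_le mum C B.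
  rewrite C1 B1; have := We mu mum; have := dR mu mum; have := Re mu mum; lra.
have caW := preimage_homeo_clopen (a^-1)%g cW.
have [||t1 [t2 [Kt1 Kt2 s1 s2 tg]]] := agree_on_clopen Kg Ka cW.
- by move=> x /aR[_ nW] Wax; apply: nW; left.
- by move=> x y Wx /aR[_ nW] gx; apply: nW; right; rewrite -gx /preimage /mkset homeoK.
have S1 : small_support e t1 by apply: (small _ _ _ Kt1 cW caW s1) => mu mum; rewrite muaW.
have S2 : small_support e t2 by apply: (small _ _ _ Kt2 caW cgW s2) => mu mum; rewrite muaW ?mugW.
have -> : g = ((t2 * t1) * ((t2 * t1)^-1 * g))%g by rewrite mulVKg.
apply: (sPM); first by apply: (sPM); exact: sub_gen_smallest.
apply: IH; first by apply: KM => //; apply: KV; exact: KM.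
move=> x nRx nWx; rewrite homeoM; have [Wx|nWix] := pselect (W i x).
  by rewrite -tg // homeoK.
have gx : g x = x.
  by apply: gfix => // j; rewrite inE => /predU1P[->//|]; exact: nWx.
rewrite gx -{1}[x](_ : (t2 * t1)%g x = x) ?homeoK // homeoM.
have naW : ~ ((a^-1)%g @^-1` W i) x.
  by move/aR => []; rewrite homeoVK => /nRx.
rewrite s1 => [|[]//]; apply: s2 => -[//|].
by rewrite -{1}gx /preimage /mkset homeoK.
Qed.

Local Notation D := (commutator_subgroup K).

Let D_K : D `<=` K. Proof. exact: commutator_subgroup_sub sK. Qed.

(** If k moves the support of a away from A, then [a, k] agrees with a on A;
    such a k exists because the support of a is at most twice as large as A. *)
Lemma commutator_clopen_comparison A B :
    clopen A -> clopen B ->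
    (forall mu, invariant_mean phi mu -> mu A < mu B /\ 3 * mu A < 1) ->
  exists2 b, D b & forall x, A x -> B (b x).
Proof.
move=> cA cB AB.
have [mu mum|a [La aAB aA]] := clopen_comparison cA cB (R := R) (phi := phi).
  by case: (AB mu mum).
pose T := A `|` a @^-1` A.
have cT : clopen T by apply: clopenU => //; exact: preimage_homeo_clopen.
have sT : supported T a by move=> x nTx; apply: aA => ?; apply: nTx; [left|right].
have [mu mum|k [Lk kT _]] := clopen_comparison cT (clopenC A cA) (R := R) (phi := phi).
  have [_ A3] := AB mu mum; rewrite (mean_setC mum).
  have := meanU_le mum A (a @^-1` A); rewrite fgl_mean //; last exact: fgl_local.
  rewrite -/T; lra.
exists (comm a k).
  by apply: commutator_subgroup_comm; exact: fgl_local.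
move=> x Ax; have nTx : ~ T ((k^-1)%g x) by move/kT; rewrite homeoVK; exact.
by rewrite /comm !homeoM (supportedV sT nTx) homeoVK; exact: aAB.
Qed.

(** Only conjugation by D is required of H, which covers at once the normal
    subgroups of K and those of D. The elements s and t of small support need
    not be in D, whence their replacement with [s, r] and [t, r2], which are in
    D and have the same commutator. *)
Lemma commutator_subgroup_minimal H :
    is_subgroup H -> nontrivial H ->
    (forall k h, D k -> H h -> H (k * h * k^-1)%g) ->
  D `<=` H.
Proof.
move=> sH nH DH; have [H1 HM HV] := sH.
have [D1 DM DV] : is_subgroup D by exact: smallest_subgroup.
have [h Hh h1] : exists2 h, H h & h <> 1%g.
  apply: contrapT => noh; apply: nH; apply/seteqP; split=> [h Hh|_ -> //].
  by apply: contrapT => h1; apply: noh; exists h.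
have [U [x0 [cU Ux0 hU]]] := displaced_clopen h1.
have DU_H f g : D f -> D g -> supported U f -> supported U g -> H (comm f g).
  move=> Df Dg sf sg; rewrite -(@comm_nested _ f g h); last first.
    apply: (supported_commute _ sg (supportedJ sf)).
    apply/seteqP; split=> y // [Uy Uhy]; apply: (hU _ Uhy).
    by rewrite homeoVK.
  have Hfh : H (comm f h).
    by apply: (HM) => //; [exact: DH|exact: HV].
  have -> : comm (comm f h) g = (comm f h * (g * (comm f h)^-1 * g^-1))%g.
    by rewrite {1}/comm !mulgA.
  by apply: (HM) => //; apply: DH => //; exact: HV.
have [d [d0 d1 dU]] := clopen_mean_lower_bound cU Ux0.
(* The supports of s and t then have a union C of mean < d / 9, and three copies
   of C have mean < d / 3, which is less than the mean of U and at most 1 / 3. *)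
have e0 : 0 < d / 18 by lra.
apply: (commutator_subgroup_generators sK (S := small_support (d / 18))) => //.
- by move=> s [].
- by move=> f Kf; exact: full_group_generators.
- by move=> k s Kk; exact: small_supportJ.
move=> s t [Ks [C1 [cC1 sC1 C1e]]] [Kt [C2 [cC2 sC2 C2e]]].
pose C := C1 `|` C2.
have cC : clopen C by exact: clopenU.
have sC : supported C s by apply: supported_sub sC1 => ?; left.
have tC : supported C t by apply: supported_sub sC2 => ?; right.
have Ce mu : invariant_mean phi mu -> mu C < d / 9.
  move=> mum; have := meanU_le mum C1 C2; rewrite -/C.
  by have := C1e _ mum; have := C2e _ mum; lra.
have [mu mum|r [Lr rC _]] := clopen_comparison cC (clopenC C cC) (R := R) (phi := phi).
  by rewrite (mean_setC mum); have := Ce mu mum; lra.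
have Kr := fgl_local Lr.
pose rC' := (r^-1)%g @^-1` C.
have crC : clopen rC' by exact: preimage_homeo_clopen.
have murC mu : invariant_mean phi mu -> mu rC' = mu C.
  by move=> mum; apply: fgl_mean => //; exact: KV.
have [mu mum|r2 [Lr2 r2C _]] :=
    clopen_comparison cC (clopenC C (clopenU cC crC)) (R := R) (phi := phi).
  rewrite (mean_setC mum); have := meanU_le mum C rC'; rewrite murC //.
  by have := Ce mu mum; lra.
have Kr2 := fgl_local Lr2.
pose r2C' := (r2^-1)%g @^-1` C.
have cr2C : clopen r2C' by exact: preimage_homeo_clopen.
have mur2C mu : invariant_mean phi mu -> mu r2C' = mu C.
  by move=> mum; apply: fgl_mean => //; exact: KV.
pose E := C `|` rC' `|` r2C'.
have cE : clopen E by apply: clopenU => //; exact: clopenU.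
have [mu mum|b Db bEU] := commutator_clopen_comparison cE cU.
  have := meanU_le mum (C `|` rC') r2C'; have := meanU_le mum C rC'.
  rewrite murC // mur2C // -/E; have := Ce mu mum; have := dU mu mum.
  by split; lra.
have CE : C `<=` E by move=> x Cx; left; left.
have C_rC : C `&` rC' = set0.
  by apply/seteqP; split=> x // [Cx /rC]; rewrite homeoVK.
have nr2C x : r2C' x -> ~ (C `|` rC') x by move/r2C; rewrite homeoVK.
pose a1 := (r * s^-1 * r^-1)%g; pose a2 := (r2 * t^-1 * r2^-1)%g.
have sa1 : supported rC' a1 by apply: supportedJ; exact: supportedV.
have sa2 : supported r2C' a2 by apply: supportedJ; exact: supportedV.
have commE (u r' : homeo X) : comm u r' = (u * (r' * u^-1 * r'^-1))%g.
  by rewrite /comm !mulgA.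
have sE : supported E (comm s r).
  rewrite commE; apply: supportedM; first exact: supported_sub CE sC.
  by apply: supported_sub sa1 => x ?; left; right.
have tE : supported E (comm t r2).
  rewrite commE; apply: supportedM; first exact: supported_sub CE tC.
  by apply: supported_sub sa2 => x ?; right.
have st : comm (comm s r) (comm t r2) = comm s t.
  rewrite (commE s r) (commE t r2) -/a1 -/a2; apply: comm_mul_commute.
  - apply: (supported_commute _ sa1 sa2).
    by apply/seteqP; split=> x // [? /nr2C]; apply; right.
  - by apply: (supported_commute _ sa1 tC); rewrite setIC.
  - apply: (supported_commute _ sa2 sC).
    by apply/seteqP; split=> x // [/nr2C + ?]; apply; left.
have bU u : supported E u -> supported U (b * u * b^-1)%g.
  move=> sEu; apply: supported_sub (supportedJ sEu) => x /bEU.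
  by rewrite homeoVK.
have DJ u : D u -> D (b * u * b^-1)%g.
  by move=> Du; apply: (DM); [exact: DM|exact: DV].
have Dsr : D (comm s r) by exact: commutator_subgroup_comm.
have Dtr : D (comm t r2) by exact: commutator_subgroup_comm.
have := DU_H _ _ (DJ _ Dsr) (DJ _ Dtr) (bU _ sE) (bU _ tE).
rewrite -comm_conj st => /(DH _ _ (DV _ Db)).
by rewrite invgK !mulgA mulVg mul1g mulgVK.
Qed.

Lemma commutator_subgroup_nontrivial : nontrivial D.
Proof.
move=> D1; have [x _] : [set: X] !=set0 by case: hphi => -[].
have e0 : 0 < 1 / 3 :> R by lra.
have [A [cA Ax Ae]] := small_clopen x e0.
have [mu mum|b] := commutator_clopen_comparison cA (clopenC A cA).
  by rewrite (mean_setC mum); have := Ae mu mum; lra.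
by rewrite D1 => -> /(_ x Ax); exact.
Qed.

Lemma commutator_subgroup_simple : simple_subgroup D.
Proof.
split; [exact: smallest_subgroup|exact: commutator_subgroup_nontrivial|].
move=> H [sH HD HJ]; have [->|/eqP nH] := eqVneq H [set 1%g]; first by left.
by right; apply/seteqP; split=> //; exact: commutator_subgroup_minimal.
Qed.

Lemma normal_subgroup_contains_commutators H :
    nontrivial H -> normal_subgroup H K \/ normal_subgroup H D -> D `<=` H.
Proof.
move=> nH [] [sH _ HJ]; apply: commutator_subgroup_minimal => // k h Dk; apply: HJ => //.
exact: D_K.
Qed.

End FullGroupLike.
End CantorMinimal.

Local Close Scope group_scope.

Theorem theorem3p4 (R : realType) (X : metricType R) (phi : homeo X)
    (hphi : cantor_minimal_system phi) :
  [/\ forall H : set (homeo X), nontrivial H ->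
        normal_subgroup H (full_group phi) \/
        normal_subgroup H (commutator_subgroup (full_group phi)) ->
        commutator_subgroup (full_group phi) `<=` H,
      forall H : set (homeo X), nontrivial H ->
        normal_subgroup H (topological_full_group phi) \/
        normal_subgroup H (commutator_subgroup (topological_full_group phi)) ->
        commutator_subgroup (topological_full_group phi) `<=` H,
      simple_subgroup (commutator_subgroup (full_group phi)) &
      simple_subgroup (commutator_subgroup (topological_full_group phi))].
Proof.
have Kf := full_group_is_full_group_like phi.
have Kt := topological_full_group_is_full_group_like hphi.
split.
- by move=> H; exact: (normal_subgroup_contains_commutators hphi Kf).
- by move=> H; exact: (normal_subgroup_contains_commutators hphi Kt).
- exact: (commutator_subgroup_simple hphi Kf).
- exact: (commutator_subgroup_simple hphi Kt).
Qed.
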